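(* Let $H=(V,S)$ be a pointed signed hypergraph. Then the pseudo-Boolean polytope $\mathcal P_{pB}(H)$ has a polynomial-size extended formulation with at most $2|V|(|S|+1)$ variables and at most $4(|S|(|V|-2)+|V|)$ inequalities. Moreover, all coefficients and right-hand side constants in the system defining $\mathcal P_{pB}(H)$ (i.e., in this extended formulation) are $0,\pm 1$.
   Context: A hypergraph is a pair $(V,E)$ with $V$ a finite set of nodes and $E$ a set of edges, which are subsets of $V$ of cardinality at least two. A signed hypergraph $H$ is a pair $(V,S)$ with $V$ a finite set of nodes and $S$ a set of signed edges. A signed edge is a pair $s=(e,\eta_s)$ with $e\subseteq V$, $|e|\ge 2$, and $\eta_s:e\to\{-1,+1\}$; $e$ is its underlying edge. No two signed edges of $S$ are identical (same $e$ and same $\eta_s$), but signed edges may be parallel (same $e$). Set-theoretic notation for $s$ refers to its underlying edge. The underlying hypergraph of $H$ is obtained by ignoring signs and dropping parallel edges. For $v\in s$, $s-v$ denotes the signed edge $(e\setminus\{v\},\eta_s|_{e\setminus\{v\}})$. A node $v$ is a $\beta$-leaf of a hypergraph if the set of its edges containing $v$ is totally ordered by inclusion. Pointed signed hypergraph: let $v\in V$ be a $\beta$-leaf of the underlying hypergraph of $H$, let $S_v$ be the set of all signed edges in $S$ containing $v$, and let $P_v:=\{s-v: s\in S_v,\ |s|\ge 3\}$. $H$ is pointed at $v$ if $V$ coincides with the underlying edge of a signed edge of maximum cardinality in $S_v$ and $S=S_v\cup P_v$. $H$ is a pointed signed hypergraph if it is pointed at some such node $v$. For a signed edge $s$ and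 $v\in s$, let $\sigma_s(z_v):=z_v$ if $\eta_s(v)=+1$ and $\sigma_s(z_v):=1-z_v$ if $\eta_s(v)=-1$. The pseudo-Boolean set is $\mathcal S_{pB}(H):=\{z\in\{0,1\}^{V\cup S}: z_s=\prod_{v\in s}\sigma_s(z_v)\ \forall s\in S\}$, and the pseudo-Boolean polytope $\mathcal P_{pB}(H)$ is its convex hull. An extended formulation of $\mathcal P_{pB}(H)$ is a finite system of linear inequalities and equalities in variables $(z,y)$, with $z$ indexed by $V\cup S$ and $y$ a vector of additional variables, whose solution set projects onto $\mathcal P_{pB}(H)$ in the $z$-space. The number of variables counts all variables $(z,y)$. It is polynomial-size if its number of variables and constraints is bounded by a polynomial in $|V|,|S|$. *)

(* Defs.v *)
From HB Require Import structures.
From mathcomp Require Import all_boot all_order all_algebra.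

Set Implicit Arguments.
Unset Strict Implicit.
Unset Printing Implicit Defensive.

Import GRing.Theory Num.Theory.

(* A pair (e, eta) with eta : e -> {-1, +1} is encoded as the partial function
   eta on V with domain e: [Some true] stands for +1, [Some false] for -1, and
   [None] for "not in e". Equality of such partial functions is equality of
   both e and eta. *)
Notation signed_edge V := {ffun V -> option bool}.

Section SignedHypergraphs.
Variable V : finType.

Record hypergraph := Hypergraph {
  edges : {set {set V}};
  edges_card : forall e, e \in edges -> 2 <= #|e| }.

Definition underlying_edge (s : signed_edge V) : {set V} :=
  [set v | s v != None].

Definition sedge_del (s : signed_edge V) (v : V) : signed_edge V :=
  [ffun u => if u == v then None else s u].

Record signed_hypergraph := SignedHypergraph {
  sedges : {set signed_edge V};
  sedges_card : forall s, s \in sedges -> 2 <= #|underlying_edge s| }.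

Lemma underlying_edges_card (H : signed_hypergraph) (e : {set V}) :
  e \in [set underlying_edge s | s in sedges H] -> 2 <= #|e|.
Proof. by case/imsetP=> s sH ->; apply: sedges_card sH. Qed.

Definition underlying_hypergraph (H : signed_hypergraph) : hypergraph :=
  Hypergraph (@underlying_edges_card H).

Definition beta_leaf (G : hypergraph) (v : V) : Prop :=
  forall e f, e \in edges G -> f \in edges G -> v \in e -> v \in f ->
    (e \subset f) || (f \subset e).

Definition sedges_at (H : signed_hypergraph) (v : V) : {set signed_edge V} :=
  [set s in sedges H | v \in underlying_edge s].

Definition sedges_at_del (H : signed_hypergraph) (v : V) : {set signed_edge V} :=
  [set sedge_del s v | s in [set s in sedges_at H v | 3 <= #|underlying_edge s|]].

Definition pointed_at (H : signed_hypergraph) (v : V) : Prop :=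
  [/\ beta_leaf (underlying_hypergraph H) v,
      exists s, [/\ s \in sedges_at H v,
        forall t, t \in sedges_at H v ->
          #|underlying_edge t| <= #|underlying_edge s|
        & underlying_edge s = [set: V]]
    & sedges H = sedges_at H v :|: sedges_at_del H v].

Definition pointed (H : signed_hypergraph) : Prop := exists v, pointed_at H v.

End SignedHypergraphs.

Local Open Scope ring_scope.

Definition conv_hull (R : realFieldType) (I : finType)
    (A : {ffun I -> R} -> Prop) (x : {ffun I -> R}) : Prop :=
  exists (k : nat) (lam : 'I_k -> R) (p : 'I_k -> {ffun I -> R}),
    [/\ forall i, A (p i), forall i, 0 <= lam i, \sum_i lam i = 1
      & forall j, x j = \sum_i lam i * p i j].

(* The index set of the vector z: the disjoint union of V and S. *)
Definition pB_index (V : finType) (H : signed_hypergraph V) : finType :=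
  (V + {s : signed_edge V | s \in sedges H})%type.

Section PseudoBoolean.
Variables (R : realFieldType) (V : finType) (H : signed_hypergraph V).

(* Only relevant for v in the underlying edge of s. *)
Definition sigma (s : signed_edge V) (v : V) (x : R) : R :=
  if s v is Some false then 1 - x else x.

Definition pB_set (z : {ffun pB_index H -> R}) : Prop :=
  (forall i, z i = 0 \/ z i = 1) /\
  (forall s : {s : signed_edge V | s \in sedges H},
     z (inr s) =
     \prod_(v in underlying_edge (val s)) sigma (val s) v (z (inl v))).

Definition pB_polytope : {ffun pB_index H -> R} -> Prop := conv_hull pB_set.

End PseudoBoolean.

Arguments pB_polytope R {V} H.

(* The pair (a, b) stands for the inequality \sum_j a j * x j <= b or for the
   equality \sum_j a j * x j = b, depending on the list in which it occurs. *)
Notation lin_constraint R J := ({ffun J -> R} * R)%type.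

Section LinearSystems.
Variables (R : realFieldType) (I : finType).

(* Variables (z, y): z is indexed by I and y by 'I_nb_aux. *)
Record ext_system := ExtSystem {
  nb_aux : nat;
  ineqs : seq (lin_constraint R (I + 'I_nb_aux)%type);
  eqs : seq (lin_constraint R (I + 'I_nb_aux)%type) }.

Definition joint (m : nat) (z : {ffun I -> R}) (y : {ffun 'I_m -> R}) :
    {ffun I + 'I_m -> R} :=
  [ffun j => match j with inl i => z i | inr k => y k end].

Definition solution (E : ext_system) (x : {ffun I + 'I_(nb_aux E) -> R}) : Prop :=
  (forall a b, (a, b) \in ineqs E -> \sum_j a j * x j <= b) /\
  (forall a b, (a, b) \in eqs E -> \sum_j a j * x j = b).

Arguments solution : clear implicits.

Definition extended_formulation (E : ext_system)
    (P : {ffun I -> R} -> Prop) : Prop :=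
  forall z, P z <-> exists y : {ffun 'I_(nb_aux E) -> R}, solution E (joint z y).

Definition nb_vars (E : ext_system) : nat := (#|I| + nb_aux E)%N.
Definition nb_ineqs (E : ext_system) : nat := size (ineqs E).
Definition nb_constraints (E : ext_system) : nat :=
  (size (ineqs E) + size (eqs E))%N.

Definition coefs_0pm1 (E : ext_system) : Prop :=
  forall a b, (a, b) \in ineqs E ++ eqs E ->
    b \in [:: 0; 1; -1] /\ forall j, a j \in [:: 0; 1; -1].

End LinearSystems.

(* q is a bivariate polynomial, evaluated at |V| and |S|. *)
Definition size_bounded (q : {poly {poly nat}}) (R : realFieldType) (V : finType)
    (H : signed_hypergraph V) (E : ext_system R (pB_index H)) : Prop :=
  (nb_vars E <= q.[#|V|, #|sedges H|])%N /\
  (nb_constraints E <= q.[#|V|, #|sedges H|])%N.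

(* Main.v *)
Require Import Defs.
From mathcomp Require Import all_boot all_order all_algebra.
From mathcomp Require Import ring lra zify.

Set Implicit Arguments.
Unset Strict Implicit.
Unset Printing Implicit Defensive.

Import Order.TTheory GRing.Theory Num.Theory.

(** Let H be pointed at v.  The edges through v form a chain, so the nodes can
    be listed as v = u_0, u_1, ... in such a way that each of these edges is an
    initial segment of the list ([beta_leaf_order]).  A signed edge through v is
    then a pattern prescribing the first few bits of a 0/1 assignment x read in
    this order, and its monomial is the indicator of the event that x matches
    the pattern.  A signed edge s avoiding v is an edge through v with v
    deleted, so its monomial is the sum of the indicators of the two patterns
    obtained from s by giving v either sign.

    A point of the polytope is the vector of expectations of these indicators
    under some distribution on assignments ([pB_polytopeP]).  Let F be the set
    of signed edges through v, with both signs of v allowed, and let the tree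
    consist of all initial segments of members of F.  The auxiliary variable Y_p
    of a tree node p stands for the probability that x matches p.  When p is a
    proper initial segment of a member of F and u is the next node in the order,
    the masses of the two one-bit extensions of p at u are linear in Y even if
    only one of them is in the tree, since they add up to Y_p.  The system says
    that these masses are nonnegative and add up correctly and that, for each
    node u and each bit c, the total mass of the extensions reading c at u is at
    most the probability that x_u = c, which z_u determines.

    Necessity is immediate ([expect_feasible]): distinct patterns that branch at
    u have the same support, hence describe disjoint events.  For sufficiency
    ([feasible_expect]) a distribution is built one node at a time.  Given a
    distribution with the right statistics for the nodes before u, the bit x_u
    is resampled.  If x currently matches a pattern p branching at u, the bit is
    1 with the conditional probability dictated by Y; otherwise it is 1 with a
    constant probability, chosen so that the overall probability of x_u = 1 is
    z_u.  The inequalities at u say exactly that this constant lies in [0, 1].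
    Resampling x_u does not disturb any event that depends on earlier nodes.

    For the size, at most one pattern branches at u_0, at most two branch at
    u_1, and at most 2|S| branch at each of the other |V| - 2 nodes; the tree is
    counted likewise.  Stating the condition at v as the single equation
    z_v = Y_(v=1), instead of two inequalities, keeps the number of inequalities
    within the bound even when |V| = 2. *)

(** * Sign patterns and the assignments matching them *)

Section Patterns.
Variable V : finType.
Implicit Types (u w : V) (p s : signed_edge V) (x : {ffun V -> bool}).

Definition matches x p : bool := [forall u, (p u == None) || (p u == Some (x u))].

Definition empty_pattern : signed_edge V := [ffun=> None].

Definition extend p u (c : bool) : signed_edge V :=
  [ffun w => if w == u then Some c else p w].

Definition restrict (D : {set V}) s : signed_edge V :=
  [ffun w => if w \in D then s w else None].

Definition assign x u (c : bool) : {ffun V -> bool} :=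
  [ffun w => if w == u then c else x w].

Lemma matchesP x p :
  reflect (forall u, p u = None \/ p u = Some (x u)) (matches x p).
Proof.
apply: (iffP forallP) => h u; first by case/orP: (h u) => /eqP; [left | right].
by apply/orP; case: (h u) => ->; [left | right].
Qed.

Lemma matches_empty x : matches x empty_pattern.
Proof. by apply/matchesP => u; left; rewrite ffunE. Qed.

Lemma matches_extend x p u c :
  p u = None -> matches x (extend p u c) = matches x p && (x u == c).
Proof.
move=> pu; apply/matchesP/andP => [h | [/matchesP h /eqP xu] w].
  split; last by case: (h u); rewrite ffunE eqxx // => -[->].
  by apply/matchesP => w; case: (eqVneq w u) (h w) => [-> _|/negPf wu];
    [left | rewrite ffunE wu].
by rewrite ffunE; case: eqVneq => [->|_]; [right; rewrite xu | apply: h].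
Qed.

Lemma matches_assign x p u c : p u = None -> matches (assign x u c) p = matches x p.
Proof.
move=> pu; apply/matchesP/matchesP => h w; have := h w; rewrite ffunE;
  by case: eqVneq => [-> _|_]; [left |].
Qed.

Lemma matches_eq x p p' :
  matches x p -> matches x p' -> (forall u, (p u == None) = (p' u == None)) -> p = p'.
Proof.
move=> /matchesP h /matchesP h' e; apply/ffunP => u; move: (e u).
by case: (h u) (h' u) => -> [] ->.
Qed.

Lemma extend_id s u c : s u = Some c -> extend s u c = s.
Proof. by move=> su; apply/ffunP => w; rewrite ffunE; case: eqP => // ->. Qed.

Lemma extend_sedge_del s u c : extend (sedge_del s u) u c = extend s u c.
Proof. by apply/ffunP => w; rewrite !ffunE; case: eqVneq. Qed.

Lemma extend_at p u c : extend p u c u = Some c.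
Proof. by rewrite ffunE eqxx. Qed.

Lemma extend_inj p u c c' : extend p u c = extend p u c' -> c = c'.
Proof. by move=> /ffunP/(_ u); rewrite !ffunE eqxx => -[]. Qed.

(** A product of literals at a 0/1 point is the indicator of a matching event;
    this turns monomials into probabilities. *)
Lemma prod_sigma (R : realFieldType) s x :
  (\prod_(u in underlying_edge s) sigma s u (x u)%:R = (matches x s)%:R :> R)%R.
Proof.
have [/matchesP h|] := boolP (matches x s).
  apply: big1 => u; rewrite inE /sigma.
  by case: (h u) => -> //; case: (x u) => //=; rewrite subr0.
rewrite negb_forall => /existsP[u]; rewrite negb_or => /andP[su sx].
rewrite (bigD1 u) ?inE //= [X in (X * _)%R](_ : _ = 0%R) ?mul0r //.
move: su sx; rewrite /sigma; case: (s u) => // -[] _; case: (x u) => //= _.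
by rewrite subrr.
Qed.

End Patterns.

(** * Expectations over a finite sample space *)
Section Expectation.
Local Open Scope ring_scope.
Variable (R : realFieldType).

Definition expect (T : finType) (mu f : T -> R) : R := \sum_x mu x * f x.

Definition distribution (T : finType) (mu : T -> R) : Prop :=
  (forall x, 0 <= mu x) /\ \sum_x mu x = 1.

Section ExpectationTheory.
Variables (T : finType) (mu : T -> R).
Hypothesis mu_distr : distribution mu.
Implicit Types f g : T -> R.

Lemma eq_expect f g : f =1 g -> expect mu f = expect mu g.
Proof. by move=> fg; apply: eq_bigr => x _; rewrite fg. Qed.

Lemma expect_cst a : expect mu (fun=> a) = a.
Proof. by rewrite /expect -mulr_suml mu_distr.2 mul1r. Qed.

Lemma expectD f g : expect mu (fun x => f x + g x) = expect mu f + expect mu g.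
Proof. by rewrite /expect -big_split; apply: eq_bigr => x _; rewrite mulrDr. Qed.

Lemma expectB f g : expect mu (fun x => f x - g x) = expect mu f - expect mu g.
Proof. by rewrite /expect -sumrB; apply: eq_bigr => x _; rewrite mulrBr. Qed.

Lemma expectZ a f : expect mu (fun x => a * f x) = a * expect mu f.
Proof. by rewrite /expect mulr_sumr; apply: eq_bigr => x _; rewrite mulrCA. Qed.

Lemma expect_sum (J : finType) (A : {set J}) (F : J -> T -> R) :
  expect mu (fun x => \sum_(j in A) F j x) = \sum_(j in A) expect mu (F j).
Proof.
by rewrite /expect exchange_big; apply: eq_bigr => x _; rewrite mulr_sumr.
Qed.

Lemma expect_ge0 f : (forall x, 0 <= f x) -> 0 <= expect mu f.
Proof. by move=> f0; apply: sumr_ge0 => x _; rewrite mulr_ge0 ?mu_distr.1. Qed.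

Lemma le_expect f g : (forall x, f x <= g x) -> expect mu f <= expect mu g.
Proof. by move=> fg; apply: ler_sum => x _; rewrite ler_wpM2l ?mu_distr.1. Qed.

End ExpectationTheory.

(** Replacing the bit of x at u by an independent coin whose bias k x may depend
    on x yields a distribution again, whose expectations are explicit. *)
Lemma resample (V : finType) (mu : {ffun V -> bool} -> R) u
    (k : {ffun V -> bool} -> R) :
  distribution mu -> (forall x, 0 <= k x <= 1) ->
  exists nu, distribution nu /\ forall f, expect nu f =
    expect mu (fun x => k x * f (assign x u true) + (1 - k x) * f (assign x u false)).
Proof.
move=> dmu k01.
pose nu y := expect mu (fun x => k x * (assign x u true == y)%:R
                               + (1 - k x) * (assign x u false == y)%:R).
have expect_nu f : expect nu f =
    expect mu (fun x => k x * f (assign x u true) + (1 - k x) * f (assign x u false)).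
  rewrite /nu /expect; under eq_bigr do rewrite mulr_suml.
  rewrite exchange_big; apply: eq_bigr => x _ /=.
  under eq_bigr do rewrite -mulrA mulrDl -!mulrA.
  rewrite -mulr_sumr big_split -!mulr_sumr /=; congr (_ * (_ * _ + _ * _)).
    rewrite (bigD1 (assign x u true)) //= eqxx mul1r big1 ?addr0 // => y.
    by rewrite eq_sym => /negPf ->; rewrite mul0r.
  rewrite (bigD1 (assign x u false)) //= eqxx mul1r big1 ?addr0 // => y.
  by rewrite eq_sym => /negPf ->; rewrite mul0r.
exists nu; split=> //; split=> [y|].
  apply: expect_ge0 => // x; have /andP[k0 k1] := k01 x.
  by rewrite addr_ge0 ?mulr_ge0 ?ler0n ?subr_ge0.
have := expect_nu (fun=> 1); rewrite /expect; under eq_bigr do rewrite mulr1.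
move=> ->; under eq_bigr do rewrite !mulr1 addrC subrK mulr1.
exact: dmu.2.
Qed.

End Expectation.

(** * The tree of initial segments of a family of patterns *)
Section PrefixTree.
Variables (V : finType) (vs : seq V) (F : {set signed_edge V}).
Implicit Types (u w : V) (p s : signed_edge V) (x : {ffun V -> bool}).

Local Notation rk u := (index u vs).

Definition before u : {set V} := [set w | rk w < rk u].
Definition upto u : {set V} := [set w | rk w <= rk u].

(** The inner nodes of the tree at which the bit of u is read; their extensions
    by that bit are the [children] at u. *)
Definition branch u : {set signed_edge V} :=
  [set restrict (before u) s | s in [set s in F | s u != None]].

Definition children u : {set signed_edge V} :=
  [set restrict (upto u) s | s in [set s in F | s u != None]].

Definition tree : {set signed_edge V} :=
  empty_pattern V |: \bigcup_u children u.

Hypothesis vs_uniq : uniq vs.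
Hypothesis vs_full : forall u, u \in vs.
Hypothesis F_initial : forall s u w,
  s \in F -> s u != None -> rk w <= rk u -> s w != None.

Lemma rk_inj u w : rk u = rk w -> u = w.
Proof. by move=> e; apply: (index_inj u) e; apply: vs_full. Qed.

Lemma extend_restrict s u c :
  s u = Some c -> extend (restrict (before u) s) u c = restrict (upto u) s.
Proof.
move=> su; apply/ffunP => w; rewrite !ffunE !inE.
case: eqVneq => [->|wu]; first by rewrite leqnn.
by rewrite [rk w <= _]leq_eqVlt; case: eqP => // /rk_inj e; rewrite e eqxx in wu.
Qed.

Lemma branchP u p :
  reflect (exists s c, [/\ s \in F, s u = Some c & p = restrict (before u) s])
          (p \in branch u).
Proof.
apply: (iffP imsetP) => [[s]|[s] [c] [sF su ->]].
  by rewrite inE => /andP[sF]; case su: (s u) => [c|] // _ ->; exists s, c.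
by exists s; rewrite // inE sF su.
Qed.

Lemma childrenP u p :
  reflect (exists s c, [/\ s \in F, s u = Some c & p = restrict (upto u) s])
          (p \in children u).
Proof.
apply: (iffP imsetP) => [[s]|[s] [c] [sF su ->]].
  by rewrite inE => /andP[sF]; case su: (s u) => [c|] // _ ->; exists s, c.
by exists s; rewrite // inE sF su.
Qed.

Lemma branch_supp u p w : p \in branch u -> (p w == None) = (rk u <= rk w).
Proof.
case/branchP => s [c] [sF su ->]; rewrite ffunE inE; case: ltnP => // wu.
by apply/negbTE/(F_initial (u := u)) => //; rewrite ?su // ltnW.
Qed.

Lemma branch_at u p : p \in branch u -> p u = None.
Proof. by move=> pu; apply/eqP; rewrite (branch_supp _ pu). Qed.

(** Since the members of F are supported on initial segments, the patterns
    branching at u all have support [before u], so the events they describe are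
    pairwise disjoint. *)
Lemma branch_eq u p p' x : p \in branch u -> p' \in branch u ->
  matches x p -> matches x p' -> p = p'.
Proof.
move=> pu pu' h h'; apply: matches_eq h h' _ => w.
by rewrite (branch_supp _ pu) (branch_supp _ pu').
Qed.

Lemma children_tree u p : p \in children u -> p \in tree.
Proof. by move=> pu; rewrite in_setU; apply/orP; right; apply/bigcupP; exists u. Qed.

Lemma empty_tree : empty_pattern V \in tree.
Proof. exact: setU11. Qed.

Lemma children_extend u p :
  p \in children u -> exists q c, q \in branch u /\ p = extend q u c.
Proof.
case/childrenP => s [c] [sF su ->]; exists (restrict (before u) s), c.
by rewrite extend_restrict //; split=> //; apply/branchP; exists s, c.
Qed.

Lemma branch_extend u p : p \in branch u -> exists c, extend p u c \in children u.
Proof.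
case/branchP => s [c] [sF su ->]; exists c; rewrite extend_restrict //.
by apply/childrenP; exists s, c.
Qed.

Lemma tree_supp p : p \in tree -> p <> empty_pattern V ->
  exists u, p \in children u /\ forall w, (p w == None) = (rk u < rk w).
Proof.
case/setU1P => // /bigcupP[u _ pu] _; exists u; split=> // w.
have [q [c [qu ->]]] := children_extend pu; rewrite ffunE.
case: (eqVneq w u) => [->|wu]; first by rewrite ltnn.
rewrite (branch_supp _ qu) [_ <= _]leq_eqVlt; case: eqP => // /rk_inj e.
by rewrite e eqxx in wu.
Qed.

(** A nonempty pattern branching at u is a child at the predecessor of u, which
    belongs to the support of any member of F reaching u. *)
Lemma branch_tree u p : p \in branch u -> p \in tree.
Proof.
case/branchP => s [c] [sF su ->].
have [u0|u_gt0] := posnP (rk u).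
  rewrite [restrict _ _](_ : _ = empty_pattern V) ?empty_tree //.
  by apply/ffunP => w; rewrite !ffunE inE u0.
have ltu : rk u < size vs by rewrite index_mem.
set w := nth u vs (rk u).-1.
have rkw : (rk w).+1 = rk u by rewrite index_uniq ?prednK // (leq_trans _ ltu) ?ltnS ?leq_pred.
have : s w != None by apply: (F_initial (u := u)); rewrite ?su // -rkw.
case sw: (s w) => [d|] // _; apply: (@children_tree w).
apply/childrenP; exists s, d; split=> //.
by congr (restrict _ s); apply/setP => w'; rewrite !inE -rkw ltnS.
Qed.

(** The inductive step in the construction of a distribution: the tree patterns
    that involve u and no later node are one-bit extensions of patterns
    branching at u. *)
Lemma tree_level i u p : rk u = i -> p \in tree ->
  (forall w, p w != None -> rk w < i.+1) ->
  (forall w, p w != None -> rk w < i) \/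
  exists q c, q \in branch u /\ p = extend q u c.
Proof.
move=> ui pT pi; have [->|/eqP p0] := eqVneq p (empty_pattern V).
  by left => w; rewrite ffunE.
have [w [pw supp]] := tree_supp pT p0.
have : rk w < i.+1 by apply: pi; rewrite supp ltnn.
rewrite ltnS leq_eqVlt => /orP[/eqP|] wi; last first.
  by left => w'; rewrite supp -leqNgt => le; apply: leq_ltn_trans wi.
right; have <- : w = u by apply: rk_inj; rewrite wi ui.
exact: children_extend.
Qed.

(** A member of F is its own initial segment up to the last node of its
    support. *)
Lemma mem_F_tree s : s \in F -> s \in tree.
Proof.
move=> sF; have [/existsP[u0 su0]|] := boolP [exists u, s u != None]; last first.
  rewrite negb_exists => /forallP s0; rewrite (_ : s = empty_pattern V) ?empty_tree //.
  by apply/ffunP => u; rewrite ffunE; apply/eqP; move: (s0 u); rewrite negbK.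
have [u su u_max] := @arg_maxnP V u0 (fun u => s u != None) (fun u => rk u) su0.
case su': (s u) su => [c|] // _; apply: (@children_tree u); apply/childrenP.
exists s, c; split=> //; apply/ffunP => w; rewrite ffunE inE.
by case: leqP => // /ltn_geF uw; apply/eqP; apply: contraFT uw; apply: u_max.
Qed.

(** ** Counting the nodes of the tree *)
Section Cardinality.

Lemma leq_card_branch u : #|branch u| <= #|F|.
Proof.
apply: leq_trans (leq_imset_card _ _) _.
by apply/subset_leq_card/subsetP => s; rewrite inE => /andP[].
Qed.

Lemma leq_card_children u : #|children u| <= #|F|.
Proof.
apply: leq_trans (leq_imset_card _ _) _.
by apply/subset_leq_card/subsetP => s; rewrite inE => /andP[].
Qed.

Lemma leq_card_children_branch u : #|children u| <= 2 * #|branch u|.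
Proof.
have sub : children u \subset
    [set extend t.1 u t.2 | t in setX (branch u) [set: bool]].
  apply/subsetP => p /children_extend[q [c [qu ->]]]; apply/imsetP.
  by exists (q, c); rewrite // !inE qu.
apply: leq_trans (subset_leq_card sub) _; apply: leq_trans (leq_imset_card _ _) _.
by rewrite cardsX cardsT card_bool mulnC.
Qed.

Variables (v w : V) (rest : seq V).
Hypothesis vsE : vs = [:: v, w & rest].

Lemma leq_card_branch_first : #|branch v| <= 1.
Proof.
rewrite -(cards1 (empty_pattern V)); apply/subset_leq_card/subsetP => p.
case/branchP => s [c] [_ _ ->]; rewrite inE; apply/eqP/ffunP => u.
by rewrite !ffunE inE vsE /= eqxx.
Qed.

Lemma leq_card_branch_second : #|branch w| <= 2.
Proof.
have wv : v != w by have := vs_uniq; rewrite vsE /= inE; case: eqP.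
have rkv : rk v = 0 by rewrite vsE /= eqxx.
have rkw : rk w = 1 by rewrite vsE /= (negPf wv) eqxx.
apply: leq_trans (_ : #|children v| <= _).
  apply/subset_leq_card/subsetP => p /branchP[s] [c] [sF sw ->].
  have : s v != None by apply: (F_initial (u := w)); rewrite ?sw ?rkv.
  case sv: (s v) => [d|] // _; apply/childrenP; exists s, d; split=> //.
  by congr (restrict _ s); apply/setP => u; rewrite !inE rkw rkv ltnS.
by apply: leq_trans (leq_card_children_branch v) _; have := leq_card_branch_first; lia.
Qed.

Lemma sum_nodes (f : V -> nat) : \sum_u f u = f v + f w + \sum_(u <- rest) f u.
Proof.
transitivity (\sum_(u <- vs) f u); last by rewrite vsE !big_cons addnA.
by rewrite [RHS]big_uniq //=; apply: eq_bigl => u; rewrite vs_full.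
Qed.

Lemma leq_sum_rest (f : V -> nat) : (forall u, f u <= #|F|) ->
  \sum_(u <- rest) f u <= size rest * #|F|.
Proof.
move=> fF; rewrite -sum1_size big_distrl /=.
by apply: leq_sum => u _; rewrite mul1n.
Qed.

Lemma leq_sum_card_branch : \sum_u #|branch u| <= 3 + size rest * #|F|.
Proof.
have := leq_sum_rest leq_card_branch; rewrite sum_nodes.
by have := leq_card_branch_first; have := leq_card_branch_second; lia.
Qed.

(** The root, at most 2 children at the first node, at most 4 at the second, and
    at most one per member of F at every node; [minn 4 #|F|] rather than 4 is
    needed when F has only two members. *)
Lemma leq_card_tree : #|tree| <= 3 + minn 4 #|F| + size rest * #|F|.
Proof.
have union : #|\bigcup_u children u| <= \sum_u #|children u|.
  apply: (big_ind2 (fun (A : {set _}) n => #|A| <= n)) => [|A m B n Am Bn|//].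
    by rewrite cards0.
  by apply: leq_trans (leq_of_leqif (leq_card_setU A B)) _; apply: leq_add.
have := leq_sum_rest leq_card_children; move: union; rewrite sum_nodes cardsU1.
have := leq_card_branch_first; have := leq_card_branch_second.
have := leq_card_children_branch v; have := leq_card_children_branch w.
by have := leq_card_children w; case: (_ \notin _) => /=; lia.
Qed.

End Cardinality.

(** ** Feasible masses and distributions *)
Section Feasible.
Local Open Scope ring_scope.
Variable (R : realFieldType).
Implicit Types (z : V -> R) (Y : signed_edge V -> R).

Definition literal (c : bool) (a : R) : R := if c then a else 1 - a.

(** The mass of the extension of p by c at u.  If that extension is not in the
    tree then its sibling is, and the mass is what the sibling leaves of the
    mass of p; hence no variable is spent on patterns outside the tree. *)
Definition child_mass Y u p c : R :=
  if extend p u c \in tree then Y (extend p u c) else Y p - Y (extend p u (~~ c)).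

Definition tree_feasible z Y : Prop :=
  [/\ Y (empty_pattern V) = 1,
      forall u p c, p \in branch u -> 0 <= child_mass Y u p c,
      forall u p, p \in branch u ->
        child_mass Y u p true + child_mass Y u p false = Y p
    & forall u c, \sum_(p in branch u) child_mass Y u p c <= literal c (z u)].

Local Notation prob mu p := (expect mu (fun x => (matches x p)%:R)).

Lemma matches_split p u x : p u = None ->
  (matches x p)%:R = (matches x (extend p u true))%:R + (matches x (extend p u false))%:R :> R.
Proof.
by move=> pu; rewrite !matches_extend //; case: (matches x p); case: (x u) => /=;
  rewrite ?mulr0n ?addr0 ?add0r.
Qed.

(** At an assignment x, a weighted sum of the indicators of the patterns
    branching at u reduces to the weight of the pattern that x matches, if
    any. *)
Lemma sum_branch u x :
  (exists p, [/\ p \in branch u, matches x p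
    & forall g : signed_edge V -> R, \sum_(q in branch u) (matches x q)%:R * g q = g p])
  \/ ((forall p, p \in branch u -> matches x p = false)
    /\ forall g : signed_edge V -> R, \sum_(q in branch u) (matches x q)%:R * g q = 0).
Proof.
have [/existsP[p /andP[pu xp]]|noP] := boolP [exists p in branch u, matches x p].
  left; exists p; split=> // g; rewrite (bigD1 p) //= xp mul1r big1 ?addr0 //.
  move=> q /andP[qu qp]; case xq: (matches x q); last by rewrite mul0r.
  by rewrite (branch_eq qu pu xq xp) eqxx in qp.
have none p : p \in branch u -> matches x p = false.
  by move=> pu; apply: contraNF noP => xp; apply/existsP; exists p; rewrite pu.
by right; split=> // g; apply: big1 => q /none ->; rewrite mul0r.
Qed.

Lemma expect_literal mu u c : distribution mu ->
  expect mu (fun x => (x u == c)%:R) = literal c (expect mu (fun x => (x u)%:R)) :> R.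
Proof.
move=> dmu; case: c => /=; first by apply: eq_expect => x; case: (x u).
rewrite -[X in _ = X - _](expect_cst dmu 1) -expectB; apply: eq_expect => x.
by case: (x u); rewrite /= ?mulr0n ?mulr1n ?subr0 ?subrr.
Qed.

Lemma child_mass_expect mu u p c : p \in branch u ->
  child_mass (fun p => prob mu p) u p c = prob mu (extend p u c) :> R.
Proof.
move=> pu; rewrite /child_mass; case: ifP => // _; rewrite -expectB.
apply: eq_expect => x; rewrite (@matches_split p u) ?(branch_at pu) //.
by case: c => /=; [rewrite addrK | rewrite addrAC subrr add0r].
Qed.

Lemma expect_feasible (mu : {ffun V -> bool} -> R) : distribution mu ->
  tree_feasible (fun u => expect mu (fun x => (x u)%:R)) (fun p => prob mu p).
Proof.
move=> dmu; split=> [|u p c pu|u p pu|u c].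
- rewrite -[RHS](expect_cst dmu 1).
  by apply: eq_expect => x; rewrite matches_empty.
- by rewrite child_mass_expect // expect_ge0 // => x; rewrite ler0n.
- rewrite !child_mass_expect // -expectD; apply: eq_expect => x.
  by rewrite -matches_split ?(branch_at pu).
rewrite -expect_literal // (eq_bigr _ (fun p => @child_mass_expect mu u p c)).
rewrite -expect_sum; apply: le_expect => // x.
rewrite (eq_bigr (fun p => (matches x p)%:R * (x u == c)%:R)) => [|p pu]; last first.
  by rewrite matches_extend ?(branch_at pu) // -mulnb natrM.
case: (sum_branch u x) => [[p [_ _ ->]]|[_ ->]]; by rewrite ?ler0n.
Qed.

(** The case t = 0 is included: then a = 0, and a / t = 0 by convention. *)
Lemma ratio_bounds (a b t : R) : 0 <= a -> 0 <= b -> a + b = t ->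
  0 <= a / t <= 1 /\ a / t * t = a.
Proof.
move=> a0 b0 <-; have [ab0|ab0] := eqVneq (a + b) 0.
  have -> : a = 0 by lra.
  by rewrite !mul0r lexx ler01.
rewrite divfK // divr_ge0 ?addr_ge0 // ler_pdivrMr ?mul1r ?lerDl //.
by rewrite lt_def ab0 addr_ge0.
Qed.

(** By induction on i, there is a distribution with the right marginals on the
    first i nodes and on the tree patterns supported there.  The step resamples
    the bit at the i-th node u.  Its bias is the conditional probability that Y
    assigns to a 1 at u, given the branching pattern matched by the assignment;
    assignments matching none share a constant bias. *)
Lemma feasible_expect z Y : tree_feasible z Y ->
  exists mu : {ffun V -> bool} -> R, [/\ distribution mu,
    forall u, expect mu (fun x => (x u)%:R) = z u
  & forall p, p \in tree -> prob mu p = Y p].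
Proof.
case=> Y0 child_ge0 balance load.
suff step i : exists mu : {ffun V -> bool} -> R, [/\ distribution mu,
    forall u, (rk u < i)%N -> expect mu (fun x => (x u)%:R) = z u
  & forall p, p \in tree -> (forall w, p w != None -> (rk w < i)%N) -> prob mu p = Y p].
  have [mu [dmu hz hY]] := step (size vs).
  exists mu; split=> // [u|p pT]; first by rewrite hz ?index_mem.
  by rewrite hY // => w _; rewrite index_mem.
elim: i => [|i [mu [dmu hz hY]]].
  pose x0 : {ffun V -> bool} := [ffun=> true].
  (* For i = 0 the only constraint is Y = 1 at the empty pattern: any
     distribution works, for instance a point mass. *)
  exists (fun x => (x == x0)%:R); have sum1 : \sum_x ((x == x0)%:R : R) = 1.
    by rewrite (bigD1 x0) //= eqxx big1 ?addr0 // => x /negPf ->.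
  have dx0 : distribution (fun x => (x == x0)%:R : R) by split=> // x; rewrite ler0n.
  split=> // p _ pw; rewrite (_ : p = empty_pattern V) ?Y0.
    by rewrite -[RHS](expect_cst dx0 1); apply: eq_expect => x; rewrite matches_empty.
  by apply/ffunP => w; rewrite ffunE; case: (p w) (pw w) => // b /(_ isT).
have [u /eqP ui|noi] := pickP [pred u | rk u == i]; last first.
  exists mu; split=> // [u|p pT pw].
    by rewrite ltnS leq_eqVlt => /orP[ui|]; [have := noi u; rewrite /= ui | apply: hz].
  apply: hY => // w /pw; rewrite ltnS leq_eqVlt => /orP[wi|//].
  by have := noi w; rewrite /= wi.
pose share p := child_mass Y u p true / Y p.
have shareP p : p \in branch u ->
    0 <= share p <= 1 /\ share p * Y p = child_mass Y u p true.
  by move=> pu; apply: ratio_bounds (balance u p pu); apply: child_ge0.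
pose SY := \sum_(p in branch u) Y p.
pose S1 := \sum_(p in branch u) child_mass Y u p true.
(* The mass 1 - SY of the assignments matching no branching pattern has to
   supply the missing probability z u - S1 of a 1 at u. *)
pose lam := (z u - S1) / (1 - SY).
have [lam01 lamK] : 0 <= lam <= 1 /\ lam * (1 - SY) = z u - S1.
  have := load u false; have := load u true; rewrite /= -/S1.
  set S0 := \sum_(p in _) _ => le1 le0.
  (* 1 - SY splits into the missing probabilities of a 1 and of a 0 at u, both
     nonnegative by the inequalities at u. *)
  apply: (@ratio_bounds _ (1 - z u - S0)); rewrite ?subr_ge0 //.
  have -> : SY = S1 + S0.
    by rewrite -big_split; apply: eq_bigr => p pu; rewrite /= balance.
  by ring.
pose k x := \sum_(p in branch u) (matches x p)%:R * share p
            + lam * (1 - \sum_(p in branch u) (matches x p)%:R * 1).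
have k01 x : 0 <= k x <= 1.
  rewrite /k; case: (sum_branch u x) => [[p [pu _ E]]|[_ E]]; rewrite !E.
    by rewrite subrr mulr0 addr0; case: (shareP p pu).
  by rewrite subr0 mulr1 add0r.
have k_match p x : p \in branch u ->
    k x * (matches x p)%:R = share p * (matches x p)%:R.
  move=> pu; case xp: (matches x p); last by rewrite !mulr0.
  rewrite /k; case: (sum_branch u x) => [[q [qu xq E]]|[no _]].
    by rewrite !E subrr mulr0 addr0 (branch_eq qu pu xq xp).
  by rewrite no in xp.
have prob_branch p : p \in branch u -> prob mu p = Y p.
  move=> pu; apply: hY => [|w]; first exact: branch_tree pu.
  by rewrite (branch_supp _ pu) -ltnNge ui.
have [nu [dnu nuE]] := resample u dmu k01.
exists nu; split=> // [w|p pT pw].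
  rewrite ltnS leq_eqVlt nuE => /orP[/eqP wi|wi].
    have -> : w = u by apply: rk_inj; rewrite wi ui.
    transitivity (expect mu k).
      by apply: eq_expect => x; rewrite !ffunE eqxx mulr1 mulr0 addr0.
    rewrite /k expectD expectZ expectB (expect_cst dmu) !expect_sum.
    rewrite [X in X + _](_ : _ = S1).
      rewrite [X in 1 - X](_ : _ = SY); first by rewrite lamK addrC subrK.
      apply: eq_bigr => p pu; rewrite -prob_branch //.
      by apply: eq_expect => x; rewrite mulr1.
    apply: eq_bigr => p pu; have [_ <-] := shareP p pu.
    by rewrite -prob_branch // -expectZ; apply: eq_expect => x; rewrite mulrC.
  rewrite -hz //; apply: eq_expect => x; rewrite !ffunE.
  case: (eqVneq w u) wi => [->|_ _]; first by rewrite ui ltnn.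
  by rewrite mulrBl mul1r addrC subrK.
rewrite nuE; case: (tree_level ui pT pw) => [pw'|[q [c [qu pE]]]].
  have pu : p u = None.
    by have := pw' u; case: (p u) => // b /(_ isT); rewrite ui ltnn.
  rewrite -hY //; apply: eq_expect => x; rewrite !matches_assign //.
  by rewrite mulrBl mul1r addrC subrK.
have nq := branch_at qu; have [_ shareK] := shareP q qu.
have -> : Y p = child_mass Y u q c by rewrite /child_mass -pE pT.
transitivity (expect mu (fun x => if c then share q * (matches x q)%:R
    else (matches x q)%:R - share q * (matches x q)%:R)).
  apply: eq_expect => x; rewrite -k_match // pE !matches_extend ?matches_assign //.
  rewrite !ffunE !eqxx; case: (c); rewrite /= ?andbT ?andbF ?mulr0 ?addr0 ?add0r //.
  by rewrite mulrBl mul1r.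
case: (c); first by rewrite expectZ prob_branch.
by rewrite expectB expectZ prob_branch // shareK -(balance _ _ qu) addrAC subrr add0r.
Qed.

(** ** Coefficients of the linear forms *)
Definition unit_coef (c : R) : bool := c \in [:: 0; 1; -1].

Definition select p : signed_edge V -> R := fun q => (q == p)%:R.

Definition child_coef u p c : signed_edge V -> R :=
  if extend p u c \in tree then select (extend p u c)
  else fun q => select p q - select (extend p u (~~ c)) q.

Lemma sum_select Y p : p \in tree -> \sum_(q in tree) select p q * Y q = Y p.
Proof.
move=> pT; rewrite (bigD1 p) //= /select eqxx mul1r big1 ?addr0 // => q /andP[_].
by move=> /negPf ->; rewrite mul0r.
Qed.

Lemma sum_child_coef Y u p c : p \in branch u ->
  \sum_(q in tree) child_coef u p c q * Y q = child_mass Y u p c.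
Proof.
move=> pu; rewrite /child_coef /child_mass; case: ifP => [|cT]; first exact: sum_select.
have [d /children_tree dT] := branch_extend pu.
have -> : ~~ c = d by move: dT cT; case: c d => [] [] // ->.
under eq_bigr do rewrite mulrBl.
by rewrite sumrB !sum_select // (branch_tree pu).
Qed.

Lemma extend_neq p u c : p u = None -> (p == extend p u c) = false.
Proof. by move=> pu; apply/eqP => /ffunP/(_ u); rewrite extend_at pu. Qed.

Lemma unit_select p q : unit_coef (select p q).
Proof. by rewrite /unit_coef /select; case: eqP; rewrite !inE eqxx ?orbT. Qed.

Lemma unit_coefN a : unit_coef (- a) = unit_coef a.
Proof. by rewrite /unit_coef !inE !eqr_oppLR opprK oppr0 orbCA orbC orbA orbAC. Qed.

Lemma unit_child_coef u p c q : p \in branch u -> unit_coef (child_coef u p c q).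
Proof.
move=> pu; rewrite /child_coef; case: ifP => _; first exact: unit_select.
rewrite /select; case: (eqVneq q p) => [->|_].
  by rewrite extend_neq ?(branch_at pu) // subr0 /unit_coef !inE eqxx orbT.
by rewrite sub0r unit_coefN; apply: unit_select.
Qed.

(** If only one extension of p is in the tree, the form vanishes identically,
    the mass of the other extension being defined by this very relation. *)
Lemma unit_balance_coef u p q : p \in branch u ->
  unit_coef (child_coef u p true q + child_coef u p false q - select p q).
Proof.
move=> pu; have nu := branch_at pu.
have [d /children_tree dT] := branch_extend pu.
have [dT'|dT'] := boolP (extend p u (~~ d) \in tree).
  rewrite /child_coef; have [-> ->] : extend p u true \in tree /\ extend p u false \in tree.
    by move: dT dT'; case: (d).
  rewrite /select; case: (eqVneq q p) => [->|_].
    by rewrite !extend_neq // addr0 sub0r unit_coefN /unit_coef !inE eqxx orbT.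
  rewrite subr0; case: (eqVneq q (extend p u true)) => [->|_].
    case: eqP => [/extend_inj //|_].
    by rewrite addr0 /unit_coef !inE eqxx orbT.
  by rewrite add0r; apply: unit_select.
have -> : child_coef u p true q + child_coef u p false q - select p q = 0.
  by rewrite /child_coef; move: dT dT'; case: (d) => /= -> /negPf ->; ring.
by rewrite /unit_coef !inE eqxx.
Qed.

(** A variable occurs in the masses of the children of p at u only if its
    pattern is p or an extension of p at u, so it determines p. *)
Lemma child_coef_parent u p c q : p \in branch u -> child_coef u p c q != 0 ->
  p = restrict (before u) q.
Proof.
move=> pu nz.
have pK : restrict (before u) p = p.
  apply/ffunP => w; rewrite ffunE inE; case: ltnP => //.
  by rewrite -(branch_supp _ pu) => /eqP ->.
have extK d : restrict (before u) (extend p u d) = p.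
  rewrite -[RHS]pK; apply/ffunP => w; rewrite !ffunE inE.
  by case: (eqVneq w u) => // ->; rewrite ltnn.
have [->|qp] := eqVneq q p; first by rewrite pK.
have [->|qc] := eqVneq q (extend p u c); first by rewrite extK.
have [->|qd] := eqVneq q (extend p u (~~ c)); first by rewrite extK.
case/eqP: nz; rewrite /child_coef /select; case: ifP => _; first by rewrite (negPf qc).
by rewrite (negPf qp) (negPf qd) subrr.
Qed.

(** No variable occurs in two summands, by [child_coef_parent], so the sum
    inherits coefficients 0, 1, -1 from its terms. *)
Lemma unit_load_coef u c q : unit_coef (\sum_(p in branch u) child_coef u p c q).
Proof.
have [qu|qu] := boolP (restrict (before u) q \in branch u).
  rewrite (bigD1 _ qu) /= big1 ?addr0; first exact: unit_child_coef.
  move=> p /andP[pu pq]; apply/eqP; apply: contraR pq => nz.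
  exact/eqP/(child_coef_parent pu nz).
rewrite big1 => [|p pu]; first by rewrite /unit_coef !inE eqxx.
by apply/eqP; apply: contraR qu => /(child_coef_parent pu) <-.
Qed.

End Feasible.
End PrefixTree.
(** * The pseudo-Boolean polytope as a set of expectations *)
Section Distributions.
Local Open Scope ring_scope.
Variables (R : realFieldType) (V : finType) (H : signed_hypergraph V).

(** A vertex is determined by its 0/1 node coordinates, so the weights of a
    convex combination of vertices form a distribution on assignments. *)
Lemma pB_polytopeP (z : {ffun pB_index H -> R}) : pB_polytope R H z <->
  exists mu : {ffun V -> bool} -> R, [/\ distribution mu,
    forall u, z (inl u) = expect mu (fun x => (x u)%:R)
  & forall s, z (inr s) = expect mu (fun x => (matches x (val s))%:R)].
Proof.
split=> [[k [lam [p [pB lam0 lam1 zE]]]]|[mu [[mu0 mu1] zV zS]]].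
  pose xi i : {ffun V -> bool} := [ffun u => p i (inl u) == 1].
  have pV i u : p i (inl u) = (xi i u)%:R.
    rewrite ffunE; have [h _] := pB i.
    by case: (h (inl u)) => ->; rewrite ?eqxx // eq_sym oner_eq0.
  have pS i s : p i (inr s) = (matches (xi i) (val s))%:R.
    have [_ ->] := pB i; rewrite -prod_sigma.
    by apply: eq_bigr => u _; rewrite pV.
  pose mu x := \sum_i lam i * (xi i == x)%:R.
  have muE f : expect mu f = \sum_i lam i * f (xi i).
    rewrite /expect /mu; under eq_bigr do rewrite mulr_suml.
    rewrite exchange_big; apply: eq_bigr => i _ /=.
    rewrite (bigD1 (xi i)) //= eqxx mulr1 big1 ?addr0 // => x.
    by rewrite eq_sym => /negPf ->; rewrite mulr0 mul0r.
  exists mu; split=> [|u|s]; last 2 first.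
  - by rewrite zE muE; apply: eq_bigr => i _; rewrite pV.
  - by rewrite zE muE; apply: eq_bigr => i _; rewrite pS.
  split=> [x|]; first by apply: sumr_ge0 => i _; rewrite mulr_ge0 ?ler0n.
  have := muE (fun=> 1); rewrite /expect; under eq_bigr do rewrite mulr1.
  by move=> ->; under eq_bigr do rewrite mulr1.
pose point (x : {ffun V -> bool}) : {ffun pB_index H -> R} :=
  [ffun j => match j with inl u => (x u)%:R | inr s => (matches x (val s))%:R end].
exists #|{ffun V -> bool}|, (fun i => mu (enum_val i)), (fun i => point (enum_val i)).
have sumE (f : {ffun V -> bool} -> R) :
    \sum_(i < #|{ffun V -> bool}|) f (enum_val i) = \sum_x f x.
  by rewrite -big_enum_val; apply: eq_bigl => x; rewrite inE.
split=> [i|i||j] //.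
- split=> [j|s].
    rewrite ffunE; case: j => [u|s].
      by case: (enum_val i u); [right | left].
    by case: matches; [right | left].
  rewrite ffunE -prod_sigma; apply: eq_bigr => u _.
  by rewrite ffunE.
- by rewrite sumE.
rewrite (sumE (fun x => mu x * point x j)).
case: j => [u|s]; rewrite ?zV ?zS; apply: eq_bigr => x _; by rewrite ffunE.
Qed.

End Distributions.

(** Put v first and sort the other nodes by decreasing number of edges through v
    that contain them.  If u is in e and w is not, then every edge through v and
    w is not inside e, hence contains e and u, whereas e itself contains u but not
    w: so u is counted strictly more often than w and comes first. *)
Lemma beta_leaf_order (V : finType) (G : hypergraph V) v : beta_leaf G v ->
  exists rest, [/\ uniq (v :: rest), forall u, u \in v :: rest
    & forall e u w, e \in edges G -> v \in e -> u \in e ->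
        index w (v :: rest) <= index u (v :: rest) -> w \in e].
Proof.
move=> leaf; pose through u := [set f in edges G | (v \in f) && (u \in f)].
pose leT : rel V := fun a b => #|through b| <= #|through a|.
have leT_total : total leT by move=> a b; apply: leq_total.
have leT_trans : transitive leT by move=> a b c ab bc; apply: leq_trans bc ab.
pose rest := sort leT [seq u <- enum V | u != v].
have mem_rest u : (u \in rest) = (u != v).
  by rewrite mem_sort mem_filter mem_enum andbT.
exists rest; split=> [|u|e u w eG ve ue].
- by rewrite /= mem_rest eqxx sort_uniq filter_uniq ?enum_uniq.
- by rewrite inE mem_rest orbN.
rewrite /= eq_sym [v == u]eq_sym; have [-> //|wv] := eqVneq w v.
have [//|uv] := eqVneq u v; rewrite ltnS.
move=> /(sorted_leq_index leT_trans _ (sort_sorted leT_total _)).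
rewrite -/rest !mem_rest => /(_ (fun=> leqnn _) wv uv); rewrite /leT leqNgt.
apply: contraNT => we; apply: proper_card; apply/properP; split.
  apply/subsetP => f; rewrite !inE => /and3P[fG vf wf]; rewrite fG vf /=.
  have /orP[/subsetP/(_ u ue) //|/subsetP/(_ w wf)] := leaf e f eG fG ve vf.
  by rewrite (negPf we).
by exists e; rewrite !inE eG ve ?ue // negb_and we orbT.
Qed.

(** * The linear system *)
Section Formulation.
Local Open Scope ring_scope.
Variables (R : realFieldType) (V : finType) (H : signed_hypergraph V).
Variables (v : V) (vs : seq V) (F : {set signed_edge V}).
Implicit Types (u : V) (p s : signed_edge V).

Local Notation T := (tree vs F).

Definition constraint (az : pB_index H -> R) (ay : signed_edge V -> R) (b : R) :
    lin_constraint R (pB_index H + 'I_#|T|)%type :=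
  ([ffun j => match j with inl i => az i | inr k => ay (enum_val k) end], b).

Definition coord (i : pB_index H) : pB_index H -> R := fun j => (j == i)%:R.

Definition branchings : {set V * signed_edge V} := [set t | t.2 \in branch vs F t.1].

Definition child_ge0 (t : V * signed_edge V * bool) :=
  constraint (fun=> 0) (fun q => - child_coef vs F R t.1.1 t.1.2 t.2 q) 0.

(** The bound by [literal c (z u)], where t = (u, c), with the node variable moved
    to the left-hand side. *)
Definition load_le (t : V * bool) :=
  constraint
    (fun j => if t.2 then - coord (inl t.1) j else coord (inl t.1) j)
    (fun q => \sum_(p in branch vs F t.1) child_coef vs F R t.1 p t.2 q)
    (~~ t.2)%:R.

Definition total_eq := constraint (fun=> 0) (select R (empty_pattern V)) 1.

Definition first_eq :=
  constraint (fun j => - coord (inl v) j)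
    (select R (extend (empty_pattern V) v true)) 0.

Definition balance_eq (t : V * signed_edge V) :=
  constraint (fun=> 0)
    (fun q => child_coef vs F R t.1 t.2 true q + child_coef vs F R t.1 t.2 false q
              - select R t.2 q) 0.

Definition edge_coef s : signed_edge V -> R :=
  if s v is Some _ then select R s
  else fun q => select R (extend s v true) q + select R (extend s v false) q.

Definition edge_eq (s : {s : signed_edge V | s \in sedges H}) :=
  constraint (fun j => - coord (inr s) j) (edge_coef (val s)) 0.

(** [load_le] is imposed at the nodes other than v only; at v, [first_eq] takes
    its place and saves two inequalities. *)
Definition prefix_system : ext_system R (pB_index H) :=
  ExtSystem
    ([seq child_ge0 t | t <- enum (setX branchings [set: bool])] ++
     [seq load_le t | t <- enum (setX [set~ v] [set: bool])])
    ([:: total_eq; first_eq] ++ [seq balance_eq t | t <- enum branchings] ++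
     [seq edge_eq e | e <- enum {: {s : signed_edge V | s \in sedges H}}]).

Hypothesis vs_uniq : uniq vs.
Hypothesis vs_full : forall u, u \in vs.
Hypothesis v_first : index v vs = 0%N.
Hypothesis F_initial : forall s u w,
  s \in F -> s u != None -> (index w vs <= index u vs)%N -> s w != None.
Hypothesis F_extend : forall s c, s \in sedges H -> extend s v c \in F.
Hypothesis H_nonempty : sedges H != set0.

Lemma branch_first : branch vs F v = [set empty_pattern V].
Proof.
apply/eqP; rewrite eqEsubset; apply/andP; split; apply/subsetP => p.
  case/branchP => s [c] [_ _ ->]; rewrite inE; apply/eqP/ffunP => u.
  by rewrite !ffunE inE v_first.
rewrite inE => /eqP ->; have [s sH] := set0Pn _ H_nonempty.
apply/branchP; exists (extend s v true), true; rewrite extend_at F_extend //; split=> //.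
by apply/ffunP => u; rewrite !ffunE inE v_first.
Qed.

Lemma extend_empty_tree c : extend (empty_pattern V) v c \in T.
Proof.
have [s sH] := set0Pn _ H_nonempty.
apply: (@children_tree _ _ _ v); apply/childrenP.
exists (extend s v c), c; rewrite extend_at F_extend //; split=> //.
apply/ffunP => u; rewrite !ffunE inE v_first leqn0.
case: eqVneq => [->|uv]; first by rewrite v_first.
case: eqP => // u0; case/eqP: uv; apply: (rk_inj vs_full).
by rewrite u0 v_first.
Qed.

Lemma extend_edge_tree s c : s \in sedges H -> extend s v c \in T.
Proof. by move=> sH; apply: mem_F_tree => //; apply: F_extend. Qed.

Lemma edge_tree s c : s \in sedges H -> s v = Some c -> s \in T.
Proof. by move=> sH sv; rewrite -(extend_id sv) extend_edge_tree. Qed.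

Section Values.
Variables (z : {ffun pB_index H -> R}) (Y : signed_edge V -> R).

Local Notation point := (joint z [ffun k : 'I_#|T| => Y (enum_val k)]).

Lemma constraint_eval az ay b :
  \sum_j (constraint az ay b).1 j * point j =
  \sum_i az i * z i + \sum_(p in T) ay p * Y p.
Proof.
rewrite big_sumType /=; congr (_ + _); first by apply: eq_bigr => i _; rewrite !ffunE.
by rewrite [RHS]big_enum_val; apply: eq_bigr => k _; rewrite !ffunE.
Qed.

Lemma sum_coord i : \sum_j coord i j * z j = z i.
Proof.
rewrite (bigD1 i) //= /coord eqxx mul1r big1 ?addr0 // => j /negPf ->.
by rewrite mul0r.
Qed.

Lemma sum_coordN i : \sum_j - coord i j * z j = - z i.
Proof. by under eq_bigr do rewrite mulNr; rewrite sumrN sum_coord. Qed.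

Definition edge_mass s : R :=
  if s v is Some _ then Y s else Y (extend s v true) + Y (extend s v false).

Lemma child_ge0P u p c : p \in branch vs F u ->
  (\sum_j (child_ge0 (u, p, c)).1 j * point j <= 0) = (0 <= child_mass vs F Y u p c).
Proof.
move=> pu; rewrite constraint_eval /= big1 ?add0r => [|i _]; last by rewrite mul0r.
under eq_bigr do rewrite mulNr.
by rewrite sumrN sum_child_coef // oppr_le0.
Qed.

Lemma load_leP u c :
  (\sum_j (load_le (u, c)).1 j * point j <= (~~ c)%:R) =
  (\sum_(p in branch vs F u) child_mass vs F Y u p c <= literal c (z (inl u))).
Proof.
rewrite constraint_eval /= [X in _ + X](_ : _ =
  \sum_(p in branch vs F u) child_mass vs F Y u p c).
  case: c => /=; first by rewrite sum_coordN addrC subr_le0.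
  by rewrite sum_coord addrC lerBrDr.
under eq_bigr do rewrite mulr_suml.
by rewrite exchange_big; apply: eq_bigr => p pu; rewrite sum_child_coef.
Qed.

Lemma total_eqP : \sum_j total_eq.1 j * point j = Y (empty_pattern V).
Proof.
rewrite constraint_eval sum_select ?empty_tree // big1 ?add0r // => i _.
by rewrite mul0r.
Qed.

Lemma first_eqP :
  \sum_j first_eq.1 j * point j = Y (extend (empty_pattern V) v true) - z (inl v).
Proof. by rewrite constraint_eval sum_coordN sum_select ?extend_empty_tree // addrC. Qed.

Lemma balance_eqP u p : p \in branch vs F u ->
  \sum_j (balance_eq (u, p)).1 j * point j =
  child_mass vs F Y u p true + child_mass vs F Y u p false - Y p.
Proof.
move=> pu; rewrite constraint_eval /= big1 ?add0r => [|i _]; last by rewrite mul0r.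
under eq_bigr do rewrite mulrBl mulrDl.
by rewrite sumrB big_split /= !sum_child_coef // sum_select // (branch_tree _ _ _ pu).
Qed.

Lemma edge_eqP e :
  \sum_j (edge_eq e).1 j * point j = edge_mass (val e) - z (inr e).
Proof.
rewrite constraint_eval sum_coordN addrC; congr (_ - _).
have eH := valP e; rewrite /edge_coef /edge_mass.
case ev: (val e v) => [c|]; first by rewrite sum_select // (edge_tree eH ev).
under eq_bigr do rewrite mulrDl.
by rewrite big_split /= !sum_select // extend_edge_tree.
Qed.

(** The load inequalities at v, absent from the system, follow from [first_eq]:
    the empty pattern is the only one branching at v, and its two children are in
    the tree. *)
Lemma prefix_solutionP :
  solution (E := prefix_system) point <->
  [/\ tree_feasible vs F (fun u => z (inl u)) Y,
      z (inl v) = Y (extend (empty_pattern V) v true)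
    & forall s : {s : signed_edge V | s \in sedges H}, z (inr s) = edge_mass (val s)].
Proof.
split=> [[le_sol eq_sol]|[[Y0 child0 balance load] zv zs]].
  have zv : z (inl v) = Y (extend (empty_pattern V) v true).
    apply/esym/eqP; rewrite -subr_eq0 -first_eqP; apply/eqP/eq_sol.
    by rewrite /= !inE eqxx orbT.
  have Y0 : Y (empty_pattern V) = 1.
    by rewrite -total_eqP; apply: eq_sol; rewrite /= !inE eqxx.
  have balance u p : p \in branch vs F u ->
      child_mass vs F Y u p true + child_mass vs F Y u p false = Y p.
    move=> pu; apply/eqP; rewrite -subr_eq0 -balance_eqP //; apply/eqP/eq_sol.
    rewrite /= !inE mem_cat; apply/orP; right; apply/orP; right; apply/orP; left.
    by apply/mapP; exists (u, p); rewrite // mem_enum inE.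
  split=> // [|s]; last first.
    apply/esym/eqP; rewrite -subr_eq0 -edge_eqP; apply/eqP/eq_sol.
    rewrite /= !inE mem_cat; apply/orP; right; apply/orP; right; apply/orP; right.
    by apply/mapP; exists s; rewrite // mem_enum.
  split=> // [u p c pu|u c].
    rewrite -child_ge0P //; apply: le_sol; rewrite mem_cat; apply/orP; left.
    by apply/mapP; exists (u, p, c); rewrite // mem_enum !inE /= pu.
  have [->|uv] := eqVneq u v; last first.
    rewrite -load_leP; apply: le_sol; rewrite mem_cat; apply/orP; right.
    by apply/mapP; exists (u, c); rewrite // mem_enum !inE /= uv.
  have bv : empty_pattern V \in branch vs F v by rewrite branch_first inE.
  rewrite branch_first big_set1 zv; have := balance v _ bv.
  by rewrite /child_mass !extend_empty_tree Y0; case: c => /=; lra.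
split=> a b.
  rewrite mem_cat => /orP[/mapP[[[u p] c]]|/mapP[[u c] _ [-> ->]]].
    by rewrite mem_enum !inE /= andbT => pu [-> ->]; rewrite child_ge0P ?child0.
  by rewrite load_leP.
rewrite /= !inE mem_cat => /or3P[/eqP[-> ->]|/eqP[-> ->]|/orP[|]].
- by rewrite total_eqP.
- by rewrite first_eqP zv subrr.
- case/mapP => -[u p]; rewrite mem_enum inE /= => pu [-> ->].
  by rewrite balance_eqP // balance // subrr.
by case/mapP => s _ [-> ->]; rewrite edge_eqP zs subrr.
Qed.

End Values.

(** For an edge avoiding v, the event that it is matched is split according to
    the bit at v. *)
Lemma expect_edge_mass (mu : {ffun V -> bool} -> R) Y s : s \in sedges H ->
  (forall p, p \in T -> expect mu (fun x => (matches x p)%:R) = Y p) ->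
  expect mu (fun x => (matches x s)%:R) = edge_mass Y s.
Proof.
move=> sH muY; rewrite /edge_mass; case sv: (s v) => [c|].
  exact: muY (edge_tree sH sv).
rewrite -!muY ?extend_edge_tree // -expectD; apply: eq_expect => x.
exact: matches_split.
Qed.

Lemma prefix_system_correct : extended_formulation prefix_system (pB_polytope R H).
Proof.
move=> z; rewrite pB_polytopeP; split=> [[mu [dmu zV zS]]|[y ysol]].
  pose Y p := expect mu (fun x => (matches x p)%:R).
  exists [ffun k : 'I_#|T| => Y (enum_val k)]; apply/prefix_solutionP; split.
  - have [Y0 child0 balance load] := expect_feasible F_initial dmu.
    by split=> // u c; rewrite zV; apply: load.
  - rewrite zV; apply: eq_expect => x.
    by rewrite matches_extend ?ffunE // matches_empty; case: (x v).
  by move=> s; rewrite zS; apply: expect_edge_mass => //; apply: valP.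
pose Y p := y (enum_rank_in (empty_tree vs F) p).
have yE : y = [ffun k : 'I_#|T| => Y (enum_val k)].
  by apply/ffunP => k; rewrite ffunE /Y enum_valK_in.
move: ysol; rewrite yE => /prefix_solutionP[feas _ zs].
have [mu [dmu muV muY]] := feasible_expect vs_uniq vs_full F_initial feas.
exists mu; split=> // s; rewrite zs; apply/esym/expect_edge_mass => //.
exact: valP.
Qed.

Lemma prefix_system_coefs : coefs_0pm1 prefix_system.
Proof.
have unit01 (b : bool) : unit_coef (b%:R : R).
  by rewrite /unit_coef; case: b; rewrite !inE eqxx ?orbT.
have unit0 : unit_coef (0 : R) := unit01 false.
have unit1 : unit_coef (1 : R) := unit01 true.
pose good (c : lin_constraint R (pB_index H + 'I_#|T|)%type) :=
  c.2 \in [:: 0; 1; -1] /\ forall j, c.1 j \in [:: 0; 1; -1].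
suff goodE c : c \in ineqs prefix_system ++ eqs prefix_system -> good c.
  by move=> a b /goodE.
have entry az ay b c' : unit_coef b ->
    (forall i, unit_coef (az i)) -> (forall p, unit_coef (ay p)) ->
    c' = constraint az ay b -> good c'.
  by move=> ub uz uy ->; split=> // -[i|k]; rewrite ffunE; [apply: uz | apply: uy].
rewrite -catA mem_cat; case/orP => [/mapP[[[u p] d]]|].
  rewrite mem_enum !inE /= andbT => pu.
  by apply: entry => // q; rewrite unit_coefN unit_child_coef.
rewrite mem_cat; case/orP => [/mapP[[u d] _]|].
  apply: entry => //= [i|q]; last exact: unit_load_coef.
  by case: d; rewrite ?unit_coefN /coord.
rewrite /= !inE; case/or3P => [/eqP|/eqP|].
- by apply: entry => // p; apply: unit_select.
- by apply: entry => // [i|p]; rewrite ?unit_coefN ?unit_select /coord.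
rewrite mem_cat; case/orP => /mapP.
  case=> -[u p]; rewrite mem_enum inE /= => pu.
  by apply: entry => // q; apply: unit_balance_coef.
case=> s _; apply: entry => // [i|q]; first by rewrite unit_coefN /coord.
rewrite /edge_coef; case: (val s v) => [_|]; first exact: unit_select.
rewrite /select; case: eqP => [->|_]; last by rewrite add0r unit01.
by case: eqP => [/extend_inj|_] //; rewrite addr0 /unit_coef !inE eqxx orbT.
Qed.

End Formulation.

(** * Size of the system *)
Section Size.
Variables (R : realFieldType) (V : finType) (H : signed_hypergraph V).
Variables (v : V) (vs : seq V) (F : {set signed_edge V}).

Local Notation E := (prefix_system R H v vs F).

Lemma card_branchings : #|branchings vs F| = \sum_u #|branch vs F u|.
Proof.
rewrite -sum1_card (eq_bigr (fun u => \sum_(p in branch vs F u) 1)) => [|u _].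
  by rewrite pair_big_dep; apply: eq_bigl => -[u p]; rewrite inE.
by rewrite sum1_card.
Qed.

Lemma card_sedge_index : #|{: {s : signed_edge V | s \in sedges H}}| = #|sedges H|.
Proof. by rewrite card_sig. Qed.

Lemma nb_vars_prefix_system : nb_vars E = #|V| + #|sedges H| + #|tree vs F|.
Proof. by rewrite /nb_vars card_sum; congr (_ + _ + _); apply: card_sedge_index. Qed.

Lemma nb_ineqs_prefix_system :
  nb_ineqs E = 2 * \sum_u #|branch vs F u| + 2 * #|V|.-1.
Proof.
rewrite /nb_ineqs size_cat !size_map -!cardE !cardsX cardsT card_bool cardsC1.
by rewrite -card_branchings !(mulnC _ 2).
Qed.

Lemma size_eqs_prefix_system :
  size (eqs E) = 2 + \sum_u #|branch vs F u| + #|sedges H|.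
Proof.
rewrite /= !size_cat !size_map -!cardE -addnA -card_branchings.
by congr (2 + (_ + _)); rewrite -card_sedge_index cardT enumT.
Qed.

End Size.

(** The outer variable stands for |V| and the inner one for |S|; the constant 20
    is generous. *)
Definition size_poly : {poly {poly nat}} := (20%:P%:P * 'X * ('X + 1)%:P)%R.

Lemma size_polyE a b : (size_poly.[a%:P].[b])%R = 20 * a * (b + 1).
Proof. by rewrite /size_poly !(hornerM, hornerC, hornerX, hornerD). Qed.

(** Here |V| = n + 2, |S| = m, and f, t, b are the sizes of F, of the tree and of
    the set of branchings. *)
Lemma size_arithmetic n m f t b : 0 < m -> f <= 2 * m ->
  t <= 3 + minn 4 f + n * f -> b <= 3 + n * f ->
  [/\ n.+2 + m + t <= 2 * (n.+2) * (m + 1),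
      2 * b + 2 * n.+1 <= 4 * (m * n + n.+2)
    & 2 * b + 2 * n.+1 + (2 + b + m) <= 20 * (n.+2) * (m + 1)].
Proof.
move=> m0 fm; have : n * f <= n * (2 * m) by rewrite leq_mul2l fm orbT.
by move=> nf t_le b_le; split; lia.
Qed.

Theorem theorem2 :
  exists q : {poly {poly nat}},
  forall (R : realFieldType) (V : finType) (H : signed_hypergraph V),
    pointed H ->
    exists E : ext_system R (pB_index H),
      [/\ extended_formulation E (pB_polytope R H),
          size_bounded q E,
          nb_vars E <= 2 * #|V| * (#|sedges H| + 1),
          nb_ineqs E <= 4 * (#|sedges H| * (#|V| - 2) + #|V|)
        & coefs_0pm1 E].
Proof.
exists size_poly => R V H [v [leaf [s0 [s0v _ s0V]] sE]].
have [rest [vs_uniq vs_full vs_initial]] := beta_leaf_order leaf.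
have s0H : s0 \in sedges H by move: s0v; rewrite inE => /andP[].
have cardV : size (v :: rest) = #|V|.
  by rewrite -(card_uniqP vs_uniq); apply: eq_card => u; rewrite vs_full.
have V_gt1 : 1 < #|V| by rewrite -cardsT -s0V; apply: sedges_card s0H.
case: rest => [|w rest] in vs_uniq vs_full vs_initial cardV *.
  by rewrite -cardV in V_gt1.
have [vs vsE] : exists vs, vs = [:: v, w & rest] by eexists.
rewrite -!vsE in vs_uniq vs_full vs_initial.
have v_first : index v vs = 0 by rewrite vsE /= eqxx.
(* [extend] overrides the sign of v: each edge through v occurs in F with both
   signs of v, as is needed for the edges avoiding v. *)
pose F := [set extend t.1 v t.2 | t in setX (sedges_at H v) [set: bool]].
have F_initial s u x : s \in F -> s u != None ->
    index x vs <= index u vs -> s x != None.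
  case/imsetP => -[t c] /setXP[/= tv _] ->; rewrite !ffunE.
  have [//|xv] := eqVneq x v.
  have [->|uv tu xu] := eqVneq u v.
    rewrite v_first leqn0 -v_first => _ /eqP /(rk_inj vs_full) xE.
    by rewrite xE eqxx in xv.
  have : x \in underlying_edge t; last by rewrite inE.
  move: tv; rewrite inE => /andP[tH tv].
  by apply: (vs_initial _ u) => //; rewrite ?inE ?imset_f.
have F_extend s c : s \in sedges H -> extend s v c \in F.
  rewrite {1}sE in_setU => /orP[sv|/imsetP[t]].
    by apply/imsetP; exists (s, c); rewrite // in_setX sv inE.
  rewrite inE => /andP[tv _] ->; rewrite extend_sedge_del.
  by apply/imsetP; exists (t, c); rewrite // in_setX tv inE.
have H_nonempty : sedges H != set0 by apply/set0Pn; exists s0.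
have cardF : #|F| <= 2 * #|sedges H|.
  apply: leq_trans (leq_imset_card _ _) _.
  rewrite cardsX cardsT card_bool mulnC leq_mul2l /=.
  by apply/subset_leq_card/subsetP => s; rewrite inE => /andP[].
have cardH : 0 < #|sedges H| by rewrite card_gt0.
have := leq_card_tree vs_uniq vs_full F_initial vsE.
have := leq_sum_card_branch vs_uniq vs_full F_initial vsE.
set B := \sum_u _ => cardB cardT.
pose E := prefix_system R H v vs F.
have nE := nb_vars_prefix_system R H v vs F.
have mE := nb_ineqs_prefix_system R H v vs F.
have kE := size_eqs_prefix_system R H v vs F.
rewrite -/B in mE kE.
have Vn : #|V| = (size rest).+2 by rewrite -cardV.
have [vars_le ineqs_le constraints_le] := size_arithmetic cardH cardF cardT cardB.
exists E; split.
- exact: prefix_system_correct.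
- rewrite /size_bounded !size_polyE /nb_constraints -/(nb_ineqs E) nE mE kE Vn.
  by split=> //; apply: leq_trans vars_le _; lia.
- by rewrite nE Vn.
- by rewrite mE Vn !subSS subn0.
- exact: prefix_system_coefs.
Qed.
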